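(* Let $b\ge2$ be an integer and $\mathbf{x}=x_1x_2\ldots$ a Sturmian word over $\{0,1,\ldots,b-1\}$. Then $$\mu\Big(\sum_{k\ge1}\frac{x_k}{b^k}\Big)=\frac{\mathrm{rep}(\mathbf{x})}{\mathrm{rep}(\mathbf{x})-1},$$ where the right-hand side is $+\infty$ if $\mathrm{rep}(\mathbf{x})=1$.
   Context: A Sturmian word is an infinite word with exactly $n+1$ distinct factors of length $n$ for every $n\ge1$. With $x_i^j=x_i\cdots x_j$, $r(n,\mathbf{x})=\min\{m\ge1:\ x_i^{i+n-1}=x_{m-n+1}^{m}\text{ for some } 1\le i\le m-n\}$ and $\mathrm{rep}(\mathbf{x})=\liminf_{n\to\infty}r(n,\mathbf{x})/n$. The irrationality exponent $\mu(\xi)$ is the supremum of the real $\mu$ such that $|\xi-p/q|<q^{-\mu}$ has infinitely many rational solutions $p/q$. *)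

(* Defs.v *)
From HB Require Import structures.
From mathcomp Require Import all_boot all_order all_algebra.
From mathcomp Require Import all_classical all_reals all_analysis.
Set Implicit Arguments. Unset Strict Implicit. Unset Printing Implicit Defensive.
Import Order.TTheory GRing.Theory Num.Theory.
Import numFieldNormedType.Exports.
Local Open Scope classical_set_scope.
Local Open Scope ring_scope.

(* Infinite words are x : nat -> nat, with letters x_1 x_2 ... (x 0 is ignored). *)

Definition factor (x : nat -> nat) (i n : nat) : seq nat :=
  [seq x (i + k)%N | k <- iota 0 n].

Definition word_over (b : nat) (x : nat -> nat) : Prop :=
  forall k, (1 <= k)%N -> (x k < b)%N.

Definition sturmian (x : nat -> nat) : Prop :=
  forall n, (1 <= n)%N ->
    exists s : seq (seq nat),
      [/\ size s = n.+1, uniq s,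
          (forall i, (1 <= i)%N -> factor x i n \in s) &
          (forall w, w \in s -> exists2 i, (1 <= i)%N & factor x i n = w)].

Definition r_admissible (x : nat -> nat) (n m : nat) : Prop :=
  (1 <= m)%N /\
  exists i, [/\ (1 <= i)%N, (i <= m - n)%N & factor x i n = factor x (m - n + 1) n].

Section Defs.
Variable R : realType.

(* r(n,x) = min of admissible m (in \bar R; +oo if there is none). *)
Definition r_fun (x : nat -> nat) (n : nat) : \bar R :=
  ereal_inf [set (m%:R)%:E | m in r_admissible x n].

Definition rep (x : nat -> nat) : \bar R :=
  limn_einf (fun n => (r_fun x n / (n%:R)%:E)%E).

Definition word_value (b : nat) (x : nat -> nat) : R :=
  limn (fun N : nat => \sum_(1 <= k < N) ((x k)%:R / (b%:R : R) ^+ k) : R).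

Definition irr_exponent (xi : R) : \bar R :=
  ereal_sup [set mu%:E | mu in
    [set mu : R | infinite_set
       [set r : rat | `|xi - ratr r| < ((denq r)%:~R : R) `^ (- mu)]]].

(* rho / (rho - 1), with value +oo when rho = 1 (and its limit value 1 at +oo). *)
Definition rep_ratio (rho : \bar R) : \bar R :=
  match rho with
  | r%:E => if r == 1 then +oo%E else (r / (r - 1))%:E
  | _ => 1%:E
  end.
End Defs.

(* Main.v *)
Require Import Defs.
From HB Require Import structures.
From mathcomp Require Import all_boot all_order all_algebra.
From mathcomp Require Import all_classical all_reals all_analysis.
From mathcomp Require Import zify ring lra.

(* Let [xi] be the number, [tail u] the number whose expansion is the word
   without its first [u] letters, and call (u, v, n) a repetition when u < v and
   the factors of length n after the first u, resp. v, letters agree.  Then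
   (b^v - b^u) xi is an integer plus tail v - tail u, and the repetition gives
   tail v - tail u = b^-n (tail (v + n) - tail (u + n)).  Hence a repetition yields
   P/Q with Q < b^v and |Q xi - P| <= b^-n, where m = v + n is admissible for
   r(n, x): this bounds the exponent from below.

   Conversely, when n is maximal, |Q xi - P| >= b^-(n + 3), because the tails then
   start with different letters and one letter of a Sturmian word is isolated.
   Given p/q, take n0 minimal with b^n0 >= 2 q.  The n0 + 2 first factors of length
   n0 contain a repetition (u, v, n0) with v <= n0 + 1, so Q = O(q).  If p/q differs
   from P/Q, then |xi - p/q| >= 1 / (2 q Q), of order q^-2.  If p/q = P/Q, extend
   the repetition to its maximal length n: the bound n (rep - 1 - eps) <= v + O(1)
   gives |xi - p/q| >= c q^-(1 + 1 / (rep - 1 - eps)). *)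

Set Implicit Arguments. Unset Strict Implicit. Unset Printing Implicit Defensive.
Import Order.TTheory GRing.Theory Num.Theory.
Import numFieldNormedType.Exports.
Local Open Scope classical_set_scope.
Local Open Scope ring_scope.

(** * Repetitions and letters in Sturmian words *)

Section Words.
Variable x : nat -> nat.
Local Open Scope nat_scope.

(* [u] and [v] count the letters skipped: the factors compared start at positions
   [u + 1] and [v + 1]. *)
Definition agree (u v n : nat) : Prop :=
  forall k, k < n -> x (u + k).+1 = x (v + k).+1.

Lemma factor_agree u v n :
  Defs.factor x u.+1 n = Defs.factor x v.+1 n <-> agree u v n.
Proof.
rewrite /Defs.factor; split=> [E k kn | E].
  have := congr1 (fun s => nth 0 s k) E.
  by rewrite !(nth_map 0) ?size_iota // !nth_iota // !add0n !addSn.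
by apply/eq_in_map => k; rewrite mem_iota add0n /= => kn; rewrite !addSn E.
Qed.

Lemma r_admissibleP n m :
  r_admissible x n m <->
  exists u v, [/\ u < v, m = v + n & agree u v n].
Proof.
split=> [[m1 [[|u] [// _ im E]]] | [u [v [uv -> E]]]].
  exists u, (m - n); split=> //; first by lia.
  by apply/factor_agree; rewrite E addn1.
split; first by lia.
exists u.+1; split=> //; first by lia.
by rewrite addnK addn1; apply/factor_agree.
Qed.

Hypothesis stx : sturmian x.

(** Pigeonhole: the [n + 2] starting positions [0], ..., [n + 1] share only [n + 1] factors. *)
Lemma sturmian_repetition n : 0 < n ->
  exists u v, [/\ u < v, v <= n.+1 & agree u v n].
Proof.
move=> n0; have [s [ss _ sP _]] := stx n0.
pose f u := Defs.factor x u.+1 n.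
have : ~~ uniq (map f (iota 0 n.+2)).
  apply/negP => us; suff : size (map f (iota 0 n.+2)) <= size s.
    by rewrite size_map size_iota ss ltnn.
  by apply: uniq_leq_size => // _ /mapP[u _ ->]; exact: sP.
move=> /(uniqPn [::])[u [v]]; rewrite size_map size_iota => -[uv vn E].
exists u, v; split=> //; apply/factor_agree.
have un := ltn_trans uv vn.
by move: E; rewrite !(nth_map 0) ?size_iota // !nth_iota.
Qed.

(** If the two tails coincided, every factor of length [v + 1] would start at one of the first [v]
    positions, whereas there are [v + 2] such factors. *)
Lemma sturmian_aperiodic u v : u < v -> exists n, x (u + n).+1 <> x (v + n).+1.
Proof.
move=> uv; apply: contrapT => /forallNP H.
have {}H k : x (u + k).+1 = x (v + k).+1 by apply: contrapT (H k).
have [//|s [ss us _ sP]] := @stx v.+1.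
suff : size s <= size (map (fun i => Defs.factor x i.+1 v.+1) (iota 0 v)).
  by rewrite ss size_map size_iota; lia.
apply: uniq_leq_size => // w /sP[[//|i] _ <-].
elim/ltn_ind: i => i IH.
have [iv|vi] := ltnP i v.
  by apply/mapP; exists i; rewrite ?mem_iota.
suff -> : Defs.factor x i.+1 v.+1 = Defs.factor x (u + (i - v)).+1 v.+1 by apply: IH; lia.
apply/factor_agree => k _.
have -> : i + k = v + (i - v + k) by lia.
by rewrite -H addnA.
Qed.

(** Otherwise [a] would repeat forever, against aperiodicity. *)
Lemma sturmian_letter_follows a c : (forall k, x k.+1 = a \/ x k.+1 = c) ->
  (exists k, x k.+1 = a) -> a <> c -> exists k, x k.+1 = a /\ x k.+2 = c.
Proof.
move=> ac [k xk] a_c; apply: contrapT => /forallNP H.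
have xa n : x (k + n).+1 = a.
  elim: n => [|n IH]; first by rewrite addn0.
  by have [|xc] := ac (k + n).+1; rewrite addnS // ; case: (H (k + n)).
have [n []] := sturmian_aperiodic (ltnSn k).
by rewrite addSnnS !xa.
Qed.

(** The words [ac] and [ca] both occur by [sturmian_letter_follows]. Since there are only three
    factors of length 2, one of [aa] and [cc] is missing. *)
Lemma sturmian_isolated_letter : exists a c, [/\ a <> c,
  (forall k, x k.+1 = a \/ x k.+1 = c) & (forall k, x k.+1 = a -> x k.+2 = c)].
Proof.
have [//|s1 [ss1 us1 s1P s1I]] := @stx 1.
case: s1 ss1 us1 s1P s1I => [//|w1 [//|w2 [|//]]] _.
rewrite /= inE andbT => w12 s1P s1I.
have [[//|i] _ Ei] : exists2 i, 0 < i & Defs.factor x i 1 = w1.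
  by apply: s1I; rewrite inE eqxx.
have [[//|j] _ Ej] : exists2 i, 0 < i & Defs.factor x i 1 = w2.
  by apply: s1I; rewrite !inE eqxx orbT.
rewrite /Defs.factor /= !addn0 in Ei Ej; subst w1 w2.
have ac k : x k.+1 = x i.+1 \/ x k.+1 = x j.+1.
  have := s1P k.+1 isT; rewrite /Defs.factor /= addn0 !inE.
  by move=> /orP[] /eqP[->]; [left|right].
have a_c : x i.+1 <> x j.+1 by move=> E; rewrite E eqxx in w12.
have xa : exists k, x k.+1 = x i.+1 by exists i.
have xc : exists k, x k.+1 = x j.+1 by exists j.
move: xa xc ac a_c {w12 s1P s1I}; move: (x i.+1) (x j.+1) => a c xa xc ac a_c.
have ca k : x k.+1 = c \/ x k.+1 = a by have [] := ac k; [right|left].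
have [[k [ka ka']]|/forallNP aa] := pselect (exists k, x k.+1 = a /\ x k.+2 = a);
  last first.
  exists a, c; split=> // k xk; have [xk'|//] := ac k.+1.
  by case: (aa k).
have [[l [lc lc']]|/forallNP cc] := pselect (exists k, x k.+1 = c /\ x k.+2 = c);
  last first.
  exists c, a; split=> //; first exact: nesym.
  by move=> l xl; have [//|xl'] := ac l.+1; case: (cc l).
have [p [pa pc]] := sturmian_letter_follows ac xa a_c.
have [q [qc qa]] := sturmian_letter_follows ca xc (nesym a_c).
have [//|s [ss us sP _]] := @stx 2.
suff : size [:: [:: a; a]; [:: c; c]; [:: a; c]; [:: c; a]] <= size s by rewrite ss.
have /eqP/negbTE a_c' := a_c; have /eqP/negbTE c_a' := nesym a_c.
apply: uniq_leq_size; first by rewrite /= !inE !eqseq_cons a_c' c_a' !andbF.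
have in_s m w : [:: x m.+1; x m.+2] = w -> w \in s.
  by move=> <-; have := sP m.+1 isT; rewrite /Defs.factor /= addn0 addn1.
move=> w; rewrite !inE => /or4P[] /eqP ->.
- by apply: (in_s k); rewrite ka ka'.
- by apply: (in_s l); rewrite lc lc'.
- by apply: (in_s p); rewrite pa pc.
- by apply: (in_s q); rewrite qc qa.
Qed.

End Words.

(** * Base-[b] expansions and their tails *)

Section Expansion.
Variables (R : realType) (b : nat) (x : nat -> nat).
Hypotheses (b2 : (2 <= b)%N) (xb : word_over b x).
Local Notation B := (b%:R : R).
Local Notation xi := (word_value R b x).

Fixpoint prefix_value (u : nat) : nat :=
  if u is u'.+1 then (b * prefix_value u' + x u)%N else 0%N.

Definition tail_value (u : nat) : R := B ^+ u * xi - (prefix_value u)%:R.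

(** Truncation of [tail_value u] to [N] letters, in Horner form so that induction can peel off the
    first letter. *)
Fixpoint tail_sum (N u : nat) : R :=
  if N is N'.+1 then ((x u.+1)%:R + tail_sum N' u.+1) / B else 0.

Local Notation partial_sum N := (\sum_(1 <= k < N) ((x k)%:R / B ^+ k)).

Lemma base_ge2 : 2 <= B. Proof. by rewrite ler_nat. Qed.

Lemma base_gt0 : 0 < B. Proof. by have := base_ge2; lra. Qed.

Lemma base_neq0 : B != 0. Proof. exact: lt0r_neq0 base_gt0. Qed.

Lemma baseX_gt0 n : 0 < B ^+ n. Proof. exact: exprn_gt0 base_gt0. Qed.

Lemma letter_le k : (x k.+1)%:R <= B - 1.
Proof.
have := xb (ltn0Sn k); case: b b2 => // b' _.
by rewrite ltnS -natr1 addrK ler_nat.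
Qed.

Lemma partial_sum_tail N u :
  B ^+ u * partial_sum (N + u).+1 - (prefix_value u)%:R = tail_sum N u.
Proof.
have B0 := base_neq0.
elim: N u => [|N IH] u /=.
  rewrite add0n; elim: u => [|u IH]; first by rewrite big_geq // mulr0 subr0.
  rewrite big_nat_recr //= mulrDr natrD natrM exprS.
  have -> : B * B ^+ u * ((x u.+1)%:R / (B * B ^+ u)) = (x u.+1)%:R.
    by rewrite mulrC divfK // mulf_neq0 // expf_neq0.
  by have := congr1 (fun z => B * z) IH; rewrite /= mulr0 => E; apply: etrans E; ring.
have := IH u.+1; rewrite addnS -addSn /= => <-.
by rewrite natrD natrM exprS; field.
Qed.

Lemma cvg_partial_sum : partial_sum N @[N --> \oo] --> xi.
Proof.
apply: nondecreasing_is_cvgn.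
  apply/nondecreasing_seqP => -[|n]; first by rewrite /= !big_geq.
  by rewrite [leRHS]big_nat_recr //= lerDl divr_ge0 // ltW // baseX_gt0.
exists 1 => _ [[|n] _ <-]; first by rewrite /= big_geq.
(* This bound telescopes: a term is at most [(B - 1) / B ^+ n.+1], a difference of consecutive
   inverse powers. *)
suff : partial_sum n.+1 <= 1 - (B ^+ n)^-1.
  by move=> /le_trans; apply; rewrite gerBl invr_ge0 ltW // baseX_gt0.
elim: n => [|n IH]; first by rewrite big_geq // expr0 invr1 subrr.
rewrite big_nat_recr //=; apply: le_trans (lerD IH (lexx _)) _.
have : (x n.+1)%:R / B ^+ n.+1 <= (B - 1) / B ^+ n.+1.
  by rewrite ler_pM2r ?invr_gt0 ?baseX_gt0 // letter_le.
have -> : (B - 1) / B ^+ n.+1 = (B ^+ n)^-1 - (B ^+ n.+1)^-1.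
  by rewrite exprS; field; rewrite base_neq0 expf_neq0 // base_neq0.
lra.
Qed.

Lemma cvg_tail_sum u : tail_sum N u @[N --> \oo] --> tail_value u.
Proof.
have H : partial_sum (N + u.+1)%N @[N --> \oo] --> xi.
  have := cvg_partial_sum.
  by rewrite -(cvg_shiftn u.+1).
rewrite (_ : tail_sum ^~ u = fun N => B ^+ u * partial_sum (N + u.+1)%N - (prefix_value u)%:R).
  by apply: cvgB; [apply: cvgMl_tmp|apply: cvg_cst].
by apply/funext => N; rewrite addnS partial_sum_tail.
Qed.

Lemma tail_valueS u : tail_value u.+1 = B * tail_value u - (x u.+1)%:R.
Proof. by rewrite /tail_value /= natrD natrM exprS; ring. Qed.

Lemma tail_value_agree u v n : agree x u v n ->
  tail_value (v + n) - tail_value (u + n) = B ^+ n * (tail_value v - tail_value u).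
Proof.
elim: n => [|n IH] H; first by rewrite !addn0 expr0 mul1r.
rewrite !addnS !tail_valueS (H n) // exprS -mulrA -IH; first by ring.
by move=> k kn; apply: H; rewrite ltnW.
Qed.

(** Geometric series: the terms [D / B ^+ k] with [k >= 1] add up to [D / (B - 1)]. *)
Lemma tail_value_dist (D : R) : (forall k l, `|(x k.+1)%:R - (x l.+1)%:R| <= D) ->
  forall u v, (B - 1) * `|tail_value u - tail_value v| <= D.
Proof.
move=> xD u v.
have Bge := base_ge2.
suff H N : (B - 1) * `|tail_sum N u - tail_sum N v| <= D.
  have C : `|tail_sum N u - tail_sum N v| @[N --> \oo]
      --> `|tail_value u - tail_value v|.
    by apply: cvg_norm; apply: cvgB; exact: cvg_tail_sum.
  have {}C : (B - 1) * `|tail_sum N u - tail_sum N v| @[N --> \oo]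
      --> (B - 1) * `|tail_value u - tail_value v| by exact: cvgMl_tmp.
  by apply: cvgr_to_le C _; exact: nearW.
elim: N u v => [|N IH] u v /=.
  by rewrite subrr normr0 mulr0; exact: le_trans (normr_ge0 _) (xD 0%N 0%N).
rewrite -mulrBl normrM normfV [`|B|]ger0_norm // mulrA ler_pdivrMr ?base_gt0 //.
have -> : (x u.+1)%:R + tail_sum N u.+1 - ((x v.+1)%:R + tail_sum N v.+1)
  = ((x u.+1)%:R - (x v.+1)%:R) + (tail_sum N u.+1 - tail_sum N v.+1) by ring.
apply: le_trans (ler_wpM2l _ (ler_normD _ _)) _; first lra.
have := IH u.+1 v.+1; have : (B - 1) * `|(x u.+1)%:R - (x v.+1)%:R| <= (B - 1) * D.
  by apply: ler_wpM2l; [lra | exact: xD].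
lra.
Qed.

Lemma tail_value_dist1 u v : `|tail_value u - tail_value v| <= 1.
Proof.
have := base_ge2; have : (B - 1) * `|tail_value u - tail_value v| <= B - 1.
  apply: tail_value_dist => k l.
  have := letter_le k; have := letter_le l.
  have : 0 <= (x k.+1)%:R :> R by [].
  have : 0 <= (x l.+1)%:R :> R by [].
  by rewrite ler_norml; lra.
nra.
Qed.

(* The isolated letter keeps the two expansions away from the ambiguity
   [w 0 (b-1) (b-1) ... = w 1 0 0 ...] of base [b] numeration. *)
Lemma tail_value_sep u v : sturmian x -> x u.+1 <> x v.+1 ->
  1 <= B ^+ 3 * `|tail_value u - tail_value v|.
Proof.
move=> /sturmian_isolated_letter[a [c [a_c ac iso]]].
have Bge := base_ge2.
wlog xu : u v / x u.+1 = c /\ x v.+1 = a.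
  move=> H uv; have [ua|uc] := ac u; have [va|vc] := ac v.
  - by case: uv; rewrite ua.
  - by rewrite distrC; apply: H => //; exact: nesym.
  - by apply: H.
  - by case: uv; rewrite uc.
move: xu => [uc va] _.
pose d : R := c%:R - a%:R.
have d1 : 1 <= `|d|.
  rewrite /d; have [lt|lt|//] := ltngtP a c.
    have : a%:R + 1 <= c%:R :> R by rewrite natr1 ler_nat.
    by have := ler_norm (c%:R - a%:R : R); lra.
  have : c%:R + 1 <= a%:R :> R by rewrite natr1 ler_nat.
  by rewrite distrC; have := ler_norm (a%:R - c%:R : R); lra.
have D k l : `|(x k.+1)%:R - (x l.+1)%:R| <= `|d|.
  have [->|->] := ac k; have [->|->] := ac l; rewrite ?subrr ?normr0 //.
  by rewrite distrC.
have E : `|tail_value u.+3 - tail_value v.+3| <= `|d|.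
  by have := tail_value_dist D u.+3 v.+3; nra.
(* Three letters decide: the remaining tails differ by at most [|d|], so [K >= 2] leaves at least
   [|d| >= 1]. The worst case is [cac] against [acc], where [K = B ^+ 2 - B]. *)
have [K K2 EK] : exists2 K : R, 2 <= K &
  B ^+ 3 * (tail_value u - tail_value v) = K * d + (tail_value u.+3 - tail_value v.+3).
  rewrite !tail_valueS uc va (iso _ va).
  have [u2|u2] := ac u.+1; rewrite u2.
    rewrite (iso _ u2); have [->|->] := ac v.+2.
      by exists (B ^+ 2 - B + 1); [nra | rewrite /d; ring].
    by exists (B ^+ 2 - B); [nra | rewrite /d; ring].
  have [->|->] := ac u.+2; have [->|->] := ac v.+2.
  - by exists (B ^+ 2); [nra | rewrite /d; ring].
  - by exists (B ^+ 2 - 1); [nra | rewrite /d; ring].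
  - by exists (B ^+ 2 + 1); [nra | rewrite /d; ring].
  - by exists (B ^+ 2); [nra | rewrite /d; ring].
rewrite -[B ^+ 3]gtr0_norm ?baseX_gt0 // -normrM EK.
have := lerB_dist (K * d) (- (tail_value u.+3 - tail_value v.+3)).
rewrite opprK normrN normrM [`|K|]gtr0_norm; last lra.
nra.
Qed.

End Expansion.

(** * Heights of rationals and finiteness of sets of approximations *)

Section Rationals.
Variable R : realType.
Local Notation denr r := ((denq r)%:~R : R).

Lemma denr_ge1 (r : rat) : 1 <= denr r.
Proof. by rewrite ler1z -gtz0_ge1 denq_gt0. Qed.

Lemma denq_frac_le (p d : int) : 0 < d -> denq (p%:~R / d%:~R) <= d.
Proof.
case: divqP => [_|k r _ kd]; first by rewrite ltxx.
have r0 := denq_gt0 r.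
have k0 : 0 < k by rewrite -(pmulr_lgt0 _ r0).
by rewrite ler_peMl ?(ltW r0) // -gtz0_ge1.
Qed.

Lemma finite_rat_height (N : nat) :
  finite_set [set r : rat | (`|numq r| <= N)%N /\ (`|denq r| <= N)%N].
Proof.
pose s := [seq (m%:Z - N%:Z)%:~R / n%:~R : rat |
            m <- iota 0 (N + N).+1, n <- map Posz (iota 0 N.+1)].
apply: (@sub_finite_set _ _ [set` s]); last exact: finite_seq.
move=> r /= [rN dN]; rewrite -(divq_num_den r).
have -> : numq r = (absz (numq r + N%:Z))%:Z - N%:Z by lia.
rewrite -(absz_denq r); apply/allpairsP.
exists (absz (numq r + N%:Z), (absz (denq r))%:Z); split=> //.
  by rewrite mem_iota /=; lia.
by apply: (map_f Posz); rewrite mem_iota /=; lia.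
Qed.

(** The two bounds on the distance combine to [q ^ (mu - tau) <= W], which bounds the denominator;
    the numerator follows because [ratr r] is within 1 of [xi]. *)
Lemma finite_approximations (xi W tau mu : R) : tau < mu -> 0 <= mu ->
  (forall r : rat, 1 <= W * denr r `^ tau * `|xi - ratr r|) ->
  finite_set [set r : rat | `|xi - ratr r| < denr r `^ (- mu)].
Proof.
move=> tm mu0 H.
pose M := W `^ (mu - tau)^-1.
pose N := Num.bound (M * (`|xi| + 1)).
apply: sub_finite_set (finite_rat_height N) => r /= lt_r.
have q1 := denr_ge1 r; set q := denr r in q1 lt_r.
have q0 : 0 < q by lra.
have tau0 : 0 < q `^ tau by exact: powR_gt0.
have mt : 0 < mu - tau by rewrite subr_gt0.
have W0 : 0 < W.
  rewrite ltNge; apply/negP => W0; have := H r; rewrite leNgt => /negP; apply.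
  apply: le_lt_trans (_ : 0 < 1) => //.
  by apply: mulr_le0_ge0 => //; apply: mulr_le0_ge0 => //; exact: ltW.
have qW : q `^ (mu - tau) <= W.
  have : 1 <= W * q `^ tau * q `^ (- mu).
    apply: le_trans (H r) _; apply: ler_wpM2l; last exact: ltW.
    by rewrite mulr_ge0 // ltW.
  rewrite -mulrA -powRD; last by rewrite (gt_eqF q0) implybT.
  rewrite (_ : tau - mu = - (mu - tau)); last by ring.
  by rewrite powRN ler_pdivlMr ?powR_gt0 // mul1r.
have qM : q <= M.
  have -> : q = (q `^ (mu - tau)) `^ (mu - tau)^-1.
    by rewrite -powRrM mulfV ?powRr1 ?ltW // lt0r_neq0.
  apply: ge0_ler_powR => //; rewrite ?nnegrE ?invr_ge0 ?powR_ge0 //; exact: ltW.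
have M0 : 0 <= M by exact: powR_ge0.
have xi0 := normr_ge0 xi.
have Nb : M * (`|xi| + 1) < N%:R by apply: archi_boundP; apply: mulr_ge0; lra.
have r1 : `|ratr r| <= `|xi| + 1.
  have : `|xi - ratr r| <= 1.
    apply: le_trans (ltW lt_r) _; rewrite powRN invf_le1 ?powR_gt0 //.
    by rewrite -(powRr0 q) ler_powR.
  by have := ler_distD xi 0 (ratr r : R); rewrite !sub0r !normrN; lra.
have num_r : (numq r)%:~R = ratr r * q :> R by rewrite divfK // lt0r_neq0.
split; rewrite -(ler_nat R).
  rewrite natr_absz intr_norm num_r normrM (gtr0_norm q0).
  apply: ltW; apply: le_lt_trans Nb; rewrite mulrC.
  by apply: ler_pM => //; exact: ltW.
rewrite natr_absz normr_denq -/q; apply: ltW; apply: le_lt_trans Nb.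
apply: le_trans qM _; rewrite ler_peMr //; lra.
Qed.

Lemma finite_rat_away (xi : R) (s : seq rat) : exists2 e : R, 0 < e &
  forall r, r \in s -> xi != ratr r -> e <= `|xi - ratr r|.
Proof.
elim: s => [|r s [e e0 IH]]; first by exists 1.
have [E|ne] := eqVneq xi (ratr r).
  exists e => // r'; rewrite inE => /orP[/eqP ->|]; first by rewrite E eqxx.
  exact: IH.
exists (Num.min e `|xi - ratr r|); first by rewrite lt_min e0 normr_gt0 subr_eq0.
move=> r'; rewrite inE => /orP[/eqP -> _|r's ne']; first by rewrite ge_min lexx orbT.
by rewrite ge_min IH.
Qed.

End Rationals.

(** * Rational approximations obtained from repetitions *)

Section Approximation.
Variables (R : realType) (b : nat) (x : nat -> nat).
Hypotheses (b2 : (2 <= b)%N) (xb : word_over b x) (stx : sturmian x).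
Local Notation B := (b%:R : R).
Local Notation xi := (word_value R b x).
Local Notation denr r := ((denq r)%:~R : R).
Local Notation A := (prefix_value b x).
Local Notation tail := (tail_value R b x).

(** For [u < v], [rep_num u v / rep_den u v] is the value of the eventually periodic word with
    preperiod [x_1 ... x_u] and period [x_(u+1) ... x_v]. *)
Definition rep_num (u v : nat) : int := (A v)%:Z - (A u)%:Z.
Definition rep_den (u v : nat) : int := (b ^ v)%N%:Z - (b ^ u)%N%:Z.

Lemma rep_numE u v : (rep_num u v)%:~R = (A v)%:R - (A u)%:R :> R.
Proof. by rewrite /rep_num rmorphB. Qed.

Lemma rep_denE u v : (rep_den u v)%:~R = B ^+ v - B ^+ u :> R.
Proof. by rewrite /rep_den rmorphB /= -!natrX. Qed.

Lemma rep_den_gt0 u v : (u < v)%N -> 0 < rep_den u v.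
Proof. by move=> uv; rewrite subr_gt0 ltz_nat ltn_exp2l. Qed.

Lemma rep_den_lt u v : (rep_den u v)%:~R < B ^+ v.
Proof. by rewrite rep_denE gtrBl; exact: baseX_gt0. Qed.

Lemma rep_linear_form u v :
  (rep_den u v)%:~R * xi - (rep_num u v)%:~R = tail v - tail u.
Proof. by rewrite rep_denE rep_numE /tail_value; ring. Qed.

Lemma rep_linear_form_le u v n : agree x u v n ->
  B ^+ n * `|(rep_den u v)%:~R * xi - (rep_num u v)%:~R| <= 1.
Proof.
move=> /(tail_value_agree R b) E; rewrite rep_linear_form.
rewrite -[B ^+ n]gtr0_norm ?baseX_gt0 // -normrM -E.
exact: tail_value_dist1.
Qed.

Lemma rep_linear_form_ge u v : (u < v)%N -> exists2 n, agree x u v n &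
  1 <= B ^+ (n + 3) * `|(rep_den u v)%:~R * xi - (rep_num u v)%:~R|.
Proof.
move=> uv; have [m /eqP xm] := sturmian_aperiodic stx uv.
have [|n xn nmin] := @ex_minnP (fun n => x (u + n).+1 != x (v + n).+1).
  by exists m.
have ag : agree x u v n.
  move=> k kn; apply/eqP; apply: contraLR kn => /nmin.
  by rewrite -leqNgt.
exists n => //; rewrite rep_linear_form addnC exprD -mulrA.
rewrite -[B ^+ n]gtr0_norm ?baseX_gt0 // -normrM -(tail_value_agree R b ag).
by apply: tail_value_sep => //; apply/eqP; rewrite eq_sym.
Qed.

Lemma infinite_approximations (mu : R) : 1 < mu ->
  (forall N, exists n u v, [/\ (N <= n)%N, (u < v)%N, agree x u v n &
     v%:R * (mu - 1) <= n%:R]) ->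
  infinite_set [set r : rat | `|xi - ratr r| < denr r `^ (- mu)].
Proof.
move=> mu1 H /finite_seqP[s sE].
have [e e0 far] := finite_rat_away xi s.
have [n [u [v [Nn uv ag vn]]]] := H (Num.bound e^-1).
have B2 := base_ge2 R b2.
have B1 : 1 <= B by lra.
(* [upper_nthrootP] gives [e^-1 < 2 ^+ n]. Hence the new fraction is closer to [xi] than any element
   of [s] other than [xi] itself. *)
have Bn : e^-1 < B ^+ n.
  by apply: lt_le_trans (upper_nthrootP Nn) _; apply: lerXn2r; rewrite ?nnegrE //; lra.
set Q : R := (rep_den u v)%:~R.
pose r : rat := (rep_num u v)%:~R / (rep_den u v)%:~R.
have d0 := rep_den_gt0 uv.
have Q1 : 1 <= Q by rewrite ler1z -gtz0_ge1.
have Q0 : 0 < Q by lra.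
have rE : ratr r = (rep_num u v)%:~R / Q by rewrite /r fmorph_div /= !ratr_int.
have dist : `|xi - ratr r| = `|Q * xi - (rep_num u v)%:~R| / Q.
  rewrite rE -[Q^-1 in RHS]gtr0_norm ?invr_gt0 // -normrM.
  by congr `|_|; field; rewrite lt0r_neq0.
have small : `|xi - ratr r| <= (B ^+ n)^-1 / Q.
  rewrite dist ler_pM2r ?invr_gt0 // -[leRHS]mulr1 ler_pdivlMl ?baseX_gt0 //.
  exact: rep_linear_form_le.
have ne : xi != ratr r.
  have [m _] := rep_linear_form_ge uv; apply: contraTneq => E.
  rewrite -/Q; have -> : Q * xi - (rep_num u v)%:~R = 0.
    by rewrite E rE mulrC divfK ?subrr // lt0r_neq0.
  by rewrite normr0 mulr0 ler10.
have [rs|] := boolP (r \in s).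
  have := far r rs ne; apply/negP; rewrite -ltNge.
  apply: le_lt_trans small _; rewrite -invfM invf_plt ?posrE ?mulr_gt0 ?baseX_gt0 //.
  by apply: lt_le_trans Bn _; rewrite ler_peMr // ltW // baseX_gt0.
move=> /negP; apply.
suff : [set r : rat | `|xi - ratr r| < denr r `^ (- mu)] r by rewrite sE.
rewrite /=; apply: le_lt_trans small _.
have den0 : 0 < denr r by rewrite ltr0z denq_gt0.
rewrite powRN -invfM ltf_pV2 ?posrE ?mulr_gt0 ?baseX_gt0 ?powR_gt0 //.
(* Reduction to lowest terms can only shrink the denominator, and then
   [Q ^ (mu - 1) < B ^ (v (mu - 1)) <= B ^ n]. *)
apply: (@le_lt_trans _ _ (Q `^ mu)).
  apply: ge0_ler_powR; rewrite ?nnegrE ?(ltW den0) ?(ltW Q0) //; first lra.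
  by rewrite ler_int; exact: denq_frac_le.
rewrite -(subrK 1 mu) powRD; last by rewrite lt0r_neq0 ?implybT.
rewrite powRr1 ?(ltW Q0) // ltr_pM2r //.
rewrite (@lt_le_trans _ _ ((B ^+ v) `^ (mu - 1))) //.
  apply: gt0_ltr_powR; rewrite ?nnegrE ?(ltW Q0) ?subr_gt0 //.
  exact: rep_den_lt.
rewrite -!powR_mulrn; [|lra|lra].
by rewrite -powRrM; exact: ler_powR.
Qed.

(** Here [sigma] stands for [rep - 1 - eps], and [K] absorbs the short repetitions. The two
    conditions on [tau] serve the cases [r] different from [P/Q] and [r] equal to [P/Q]. *)
Lemma approximation_lower_bound (sigma K tau : R) :
  0 < sigma -> 2 <= tau -> 1 + sigma^-1 <= tau ->
  (forall u v n, (u < v)%N -> agree x u v n -> n%:R * sigma <= v%:R + K) ->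
  exists W : R, forall r : rat, 1 <= W * denr r `^ tau * `|xi - ratr r|.
Proof.
move=> s0 tau2 taus H.
have B2 := base_ge2 R b2; have B1 : 1 <= B by lra.
have BX := baseX_gt0 R b2.
(* Chosen so that [B ^ (v + K) <= C q]; the witness below adds up the constants of the two cases. *)
pose C : R := 2 * B ^+ 2 * B `^ K.
have C0 : 0 <= C by rewrite !mulr_ge0 ?powR_ge0 // ltW.
exists (4 * B ^+ 2 + 2 * B ^+ 5 * C `^ sigma^-1) => r.
have q1 := denr_ge1 R r; set q := denr r in q1 *; have q0 : 0 < q by lra.
pose d := `|denq r|%N.
have dE : d%:R = q by rewrite natr_absz normr_denq.
have d0 : (0 < d)%N by rewrite absz_gt0 denq_neq0.
have d2 : (1 < 2 * d)%N by lia.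
have := up_log_bounds b2 d2; set n0 := up_log b (2 * d) => /= /andP[lo hi].
have n00 : (0 < n0)%N by rewrite up_log_gt0 b2.
have [u [v [uv vn ag]]] := sturmian_repetition stx n00.
have Bhi : 2 * q <= B ^+ n0 by rewrite -dE -natrX -natrM ler_nat.
have Bv : B ^+ v <= 2 * B ^+ 2 * q.
  apply: (@le_trans _ _ (B ^+ (2 + n0.-1))).
    by apply: ler_weXn2l => //; lia.
  have -> : 2 * B ^+ 2 * q = B ^+ 2 * (2 * q) by ring.
  rewrite exprD; apply: ler_wpM2l; first exact: ltW.
  by rewrite -dE -natrX -natrM ler_nat; exact: ltnW.
set Q : R := (rep_den u v)%:~R; set P : R := (rep_num u v)%:~R.
have Qle : Q <= 2 * B ^+ 2 * q by apply: le_trans Bv; apply: ltW; exact: rep_den_lt.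
have Q1 : 1 <= Q by rewrite ler1z -gtz0_ge1 rep_den_gt0.
have Q0 : 0 < Q by lra.
set y := `|xi - ratr r|; have y0 : 0 <= y by exact: normr_ge0.
have num_r : (numq r)%:~R = ratr r * q :> R by rewrite divfK // lt0r_neq0.
have W1 : 0 <= 4 * B ^+ 2 by rewrite mulr_ge0 // ltW.
have W2 : 0 <= 2 * B ^+ 5 * C `^ sigma^-1 by rewrite !mulr_ge0 ?powR_ge0 // ltW.
have qt0 := powR_ge0 q tau.
(* If the fractions differ, the cross difference is a nonzero integer. The choice of [n0] makes
   [q |Q xi - P|] at most 1/2, so [Q q y] is at least 1/2. *)
have [E|ne] := eqVneq (rep_num u v * denq r) (numq r * rep_den u v); last first.
  have ge1 : 1 <= `|P * q - ratr r * q * Q|.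
    rewrite -num_r -/P /q /Q -!intrM -rmorphB /= -intr_norm ler1z.
    by rewrite -gtz0_ge1 normr_gt0 subr_eq0.
  have half : q * `|Q * xi - P| <= 2^-1.
    have := rep_linear_form_le ag; rewrite -/Q -/P.
    have := normr_ge0 (Q * xi - P); nra.
  have : `|P * q - ratr r * q * Q| <= q * `|Q * xi - P| + Q * q * y.
    have -> : P * q - ratr r * q * Q = q * (P - Q * xi) + Q * q * (xi - ratr r) by ring.
    apply: le_trans (ler_normD _ _) _.
    by rewrite !normrM (gtr0_norm q0) (gtr0_norm Q0) [`|P - _|]distrC.
  move=> tri.
  have Qqy : 2^-1 <= Q * (q * y) by lra.
  have qy0 : 0 <= q * y by rewrite mulr_ge0 // ltW.
  have : 1 <= 4 * B ^+ 2 * q ^+ 2 * y by have := ler_wpM2r qy0 Qle; lra.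
  move=> /le_trans; apply; apply: ler_wpM2r => //.
  apply: ler_pM => //; rewrite ?lerDl // ?exprn_ge0 ?(ltW q0) //.
  by rewrite -powR_mulrn ?(ltW q0) // ler_powR.
have [n agn] := rep_linear_form_ge uv; rewrite -/Q -/P.
have -> : P = ratr r * Q.
  apply: (mulIf (lt0r_neq0 q0)); rewrite mulrAC -num_r /P /Q /q -!intrM.
  by rewrite E.
rewrite (_ : Q * xi - _ = Q * (xi - ratr r)); last by ring.
rewrite normrM (gtr0_norm Q0) -/y => ge1.
(* Raise [B ^ (n sigma) <= B ^ (v + K) <= C q] to the power [1 / sigma]. *)
have Bn : B ^+ n <= C `^ sigma^-1 * q `^ sigma^-1.
  rewrite -powRM ?(ltW q0) //.
  have -> : B ^+ n = (B `^ (n%:R * sigma)) `^ sigma^-1.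
    by rewrite -powRrM mulfK ?lt0r_neq0 // powR_mulrn //; lra.
  apply: ge0_ler_powR; rewrite ?nnegrE ?powR_ge0 ?mulr_ge0 ?invr_ge0 ?(ltW q0) ?(ltW s0) //.
  apply: le_trans (ler_powR B1 (H _ _ _ uv agn)) _.
  rewrite powRD; last by rewrite (gt_eqF (base_gt0 R b2)) implybT.
  rewrite powR_mulrn; last lra.
  by rewrite /C mulrAC; apply: ler_wpM2r => //; exact: powR_ge0.
apply: le_trans ge1 _; rewrite mulrA; apply: ler_wpM2r => //.
apply: (@le_trans _ _ (2 * B ^+ 5 * C `^ sigma^-1 * q `^ tau)); last first.
  by apply: ler_wpM2r => //; rewrite lerDr.
apply: (@le_trans _ _ (2 * B ^+ 5 * C `^ sigma^-1 * q `^ (1 + sigma^-1))); last first.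
  by apply: ler_wpM2l => //; exact: ler_powR.
rewrite powRD; last by rewrite lt0r_neq0 ?implybT.
rewrite powRr1 ?(ltW q0) // addnC exprD.
have -> : 2 * B ^+ 5 * C `^ sigma^-1 * (q * q `^ sigma^-1)
  = B ^+ 3 * (C `^ sigma^-1 * q `^ sigma^-1) * (2 * B ^+ 2 * q) by ring.
apply: ler_pM => //; rewrite ?mulr_ge0 ?(ltW (BX _)) ?(ltW Q0) //.
by rewrite ler_pM2l.
Qed.

End Approximation.

(** * The exponent [rep] in terms of repetitions *)

Section Repetition.
Variables (R : realType) (x : nat -> nat).
Local Notation ratio := (fun n => (r_fun R x n / (n%:R)%:E)%E).

Lemma rep_sup : rep R x = ereal_sup (range (einfs ratio)).
Proof. by rewrite /rep limn_einf_lim; apply/cvg_lim => //; exact: cvg_einfs_sup. Qed.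

Lemma divn_eE (y : \bar R) (n : nat) : (0 < n)%N ->
  (y / (n%:R)%:E = y * (n%:R^-1)%:E)%E.
Proof. by move=> n0; rewrite inver pnatr_eq0 eqn0Ngt n0. Qed.

Lemma rep_gt (y : R) : (y%:E < rep R x)%E ->
  exists N, forall n u v, (N <= n)%N -> (u < v)%N -> agree x u v n ->
    y * n%:R <= (v + n)%:R.
Proof.
rewrite rep_sup => /ereal_sup_gt[_ [N _ <-]] yN.
(* The shift to [N.+1] excludes [n = 0], where the quotient is not a genuine one. *)
exists N.+1 => n u v Nn uv ag; have n0 : (0 < n)%N by lia.
have : (y%:E <= r_fun R x n / (n%:R)%:E)%E.
  apply/ltW/(lt_le_trans yN); apply: ereal_inf_lbound.
  by exists n => //=; exact: ltnW.
rewrite divn_eE // lee_pdivlMr ?ltr0n // => /le_trans H.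
rewrite -lee_fin EFinM; apply: H; apply: ereal_inf_lbound.
by exists (v + n)%N => //; apply/r_admissibleP; exists u, v.
Qed.

Lemma rep_lt (y : R) : (rep R x < y%:E)%E ->
  forall N, exists n u v, [/\ (N <= n)%N, (0 < n)%N, (u < v)%N, agree x u v n &
    (v + n)%:R < y * n%:R].
Proof.
rewrite rep_sup => supy N.
have : (einfs ratio N.+1 < y%:E)%E.
  by apply: le_lt_trans supy; apply: ereal_sup_ubound; exists N.+1.
move=> /ereal_inf_lt[_ [n /= Nn <-]].
have n0 : (0 < n)%N by lia.
rewrite divn_eE // lte_pdivrMr ?ltr0n // => /ereal_inf_lt[_ [m + <-]].
move=> /r_admissibleP[u [v [uv -> ag]]]; rewrite -EFinM lte_fin => lt.
by exists n, u, v; split=> //; exact: ltnW.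
Qed.

Lemma rep_ge1 : (1 <= rep R x)%E.
Proof.
rewrite leNgt; apply/negP => /rep_lt/(_ 0%N)[n [u [v [_ _ _ _]]]].
by rewrite mul1r ltr_nat; lia.
Qed.

(** By [sturmian_repetition], [r(n, x) <= 2 n + 1]. This makes [1 + 1 / (rep - 1)] at least 2 when
    [rep > 1], the range covered by [irr_exponent_le]. *)
Lemma sturmian_rep_le2 : sturmian x -> (rep R x <= 2%:E)%E.
Proof.
move=> stx; rewrite leNgt; apply/negP => rep2.
have [y y2 yrep] : exists2 y : R, 2 < y & (y%:E < rep R x)%E.
  case: (rep R x) rep2 => [r| |//]; rewrite ?lte_fin => r2.
    by exists ((2 + r) / 2); rewrite ?lte_fin; lra.
  by exists 3; rewrite ?ltry //; lra.
have [N H] := rep_gt yrep.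
(* With [n > 1 / (y - 2)], [y n] exceeds [2 n + 1]. *)
pose n := maxn N (Num.bound (y - 2)^-1).+1.
have [u [v [uv vn ag]]] := @sturmian_repetition x stx n ltac:(lia).
have := H n u v ltac:(lia) uv ag.
have : (v + n)%:R <= n%:R + n%:R + 1 :> R by rewrite -!natrD natr1 ler_nat; lia.
have : (y - 2)^-1 < n%:R.
  apply: lt_le_trans (archi_boundP _) _; first by rewrite invr_ge0; lra.
  by rewrite ler_nat; lia.
rewrite invf_plt ?posrE ?ltr0n; [|lra|lia].
have n0 : 0 < n%:R :> R by rewrite ltr0n; lia.
rewrite -(ltr_pM2r n0) mulVf ?lt0r_neq0 //; lra.
Qed.

End Repetition.

(** * The two bounds on the irrationality exponent *)

Section Exponent.
Variables (R : realType) (b : nat) (x : nat -> nat).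
Hypotheses (b2 : (2 <= b)%N) (xb : word_over b x) (stx : sturmian x).
Local Notation xi := (word_value R b x).

Lemma irr_exponent_ge (mu : R) : 1 < mu -> (rep R x < (1 + (mu - 1)^-1)%:E)%E ->
  (mu%:E <= irr_exponent xi)%E.
Proof.
move=> mu1 /rep_lt H; apply: ereal_sup_ubound; exists mu => //=.
apply: infinite_approximations => // N.
have [n [u [v [Nn _ uv ag lt]]]] := H N; exists n, u, v; split=> //.
have m0 : 0 < mu - 1 by lra.
rewrite natrD mulrDl mul1r addrC ltrD2l in lt.
by rewrite -ler_pdivlMr // mulrC ltW.
Qed.

Lemma irr_exponent_le (t : R) : 2 <= t -> ((1 + (t - 1)^-1)%:E <= rep R x)%E ->
  (irr_exponent xi <= t%:E)%E.
Proof.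
move=> t2 trep; apply: ge_ereal_sup => _ [mu /= inf_mu <-].
rewrite lee_fin leNgt; apply/negP => t_mu; apply: inf_mu.
(* Strictness on both sides gives [1 + sigma < rep] and [1 + 1 / sigma < mu]. *)
have [sigma ms st] : exists2 sigma : R, (mu - 1)^-1 < sigma & sigma < (t - 1)^-1.
  have lt : (mu - 1)^-1 < (t - 1)^-1 by rewrite ltf_pV2 ?posrE; lra.
  by exists (((mu - 1)^-1 + (t - 1)^-1) / 2); lra.
have m0 : 0 < (mu - 1)^-1 by rewrite invr_gt0; lra.
have s0 : 0 < sigma by lra.
have s_mu : 1 + sigma^-1 < mu.
  by rewrite addrC -ltrBrDr invf_plt ?posrE //; lra.
have /rep_gt[N HN] : ((1 + sigma)%:E < rep R x)%E.
  by apply: lt_le_trans trep; rewrite lte_fin; lra.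
pose tau := Num.max 2 (1 + sigma^-1).
(* The constant [N sigma] covers the repetitions shorter than [N], about which [rep_gt] says
   nothing. *)
have [|||W HW] := @approximation_lower_bound R b x b2 xb stx sigma (N%:R * sigma) tau s0.
- by rewrite le_max lexx.
- by rewrite le_max lexx orbT.
- move=> u v n uv ag; have [Nn|/ltnW nN] := leqP N n.
    have Ns : 0 <= N%:R * sigma by rewrite mulr_ge0 // ltW.
    by have := HN n u v Nn uv ag; rewrite natrD; lra.
  apply: le_trans (_ : N%:R * sigma <= _); last by rewrite lerDr.
  by rewrite ler_pM2r // ler_nat.
apply: finite_approximations HW; last lra.
by rewrite gt_max s_mu andbT; lra.
Qed.

End Exponent.

Theorem theorem4p5 (R : realType) (b : nat) (x : nat -> nat) :
  (2 <= b)%N -> word_over b x -> sturmian x ->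
  irr_exponent (word_value R b x) = rep_ratio (rep R x).
Proof.
move=> b2 xb stx.
have ge := @irr_exponent_ge R b x b2 xb stx.
have le := @irr_exponent_le R b x b2 xb stx.
have := rep_ge1 R x; have := sturmian_rep_le2 R stx.
case: (rep R x) ge le => [r| |] ge le //=; rewrite !lee_fin => r2 r1.
have [r_1|rn1] := eqVneq r 1.
  (* When [rep = 1], every [mu > 1] is a lower bound for the exponent; smaller [mu] are compared
     with 2. *)
  apply/eqyP => mu mu0; have [mu1|mu1] := ltP 1 mu.
    by apply: ge => //; rewrite lte_fin r_1 ltrDl invr_gt0; lra.
  apply: (@le_trans _ _ 2%:E); first by rewrite lee_fin; lra.
  by apply: ge; [lra | rewrite lte_fin r_1 ltrDl invr_gt0; lra].
have r0 : 0 < r - 1 by rewrite subr_gt0 lt_neqAle eq_sym rn1.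
have rV1 : 1 <= (r - 1)^-1 by rewrite invf_ge1 //; lra.
have -> : r / (r - 1) = 1 + (r - 1)^-1.
  by field; rewrite lt0r_neq0.
apply/eqP; rewrite eq_le; apply/andP; split.
  by apply: le; [lra | rewrite lee_fin addrAC subrr add0r invrK; lra].
apply/lee_addgt0Pr => e e0.
(* The cap 1/2 keeps [1 + 1 / (r - 1) - d] above 1, as [irr_exponent_ge] requires. *)
pose d := Num.min e 2^-1.
have d0 : 0 < d by rewrite lt_min e0; lra.
have de : d <= e by rewrite ge_min lexx.
have dh : d <= 2^-1 by rewrite ge_min lexx orbT.
apply: (@le_trans _ _ ((1 + (r - 1)^-1 - d)%:E + e%:E)%E).
  by rewrite -EFinD lee_fin; lra.
apply: leeD => //; apply: ge; first lra.
rewrite lte_fin -ltrBlDl -invf_pgt ?posrE //; lra.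
Qed.
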